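(* Let $n\ge 1$ be an integer. Let $T\subseteq[n]$ and write $[n]\setminus T=\{v_1<\cdots<v_m\}$. Then for all $p\in[n]$ and all sets $S\subseteq[n]\setminus\{p\}$ with $|S|=|T|+1$, $$(-1)^{1+l}\sum_{k=1}^{l}(-1)^{1+k}\det A\big(S\,\big|\,T\cup\{v_k\}\big)\,\det A\big([n]\setminus\{p\}\,\big|\,[n]\setminus\{v_k\}\big)\ \ge\ 0$$ for all $l\in\{1,\dots,m\}$ and all $n\times n$ totally nonnegative matrices $A$.
   Context: $[n]=\{1,\dots,n\}$. For $X,Y\subseteq[n]$, $A(X|Y)$ is the submatrix of $A$ with row indices in $X$ and column indices in $Y$ (in increasing order); the determinant of the empty submatrix is $1$. A real matrix is totally nonnegative (TN) if the determinant of each of its square submatrices is $\ge 0$. *)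

(* Defs.v *)
From HB Require Import structures.
From mathcomp Require Import all_boot all_order all_algebra.
From mathcomp Require Import reals.

Set Implicit Arguments.
Unset Strict Implicit.
Unset Printing Implicit Defensive.

Import Order.TTheory GRing.Theory Num.Theory.

Local Open Scope ring_scope.

(* [enum_val] lists the elements of a set of ordinals in increasing order
   (see [enum_val_ltn] below). *)
Definition submx_on (R : Type) (n : nat) (A : 'M[R]_n) (X Y : {set 'I_n}) :
    'M[R]_(#|X|, #|Y|) :=
  mxsub (@enum_val _ (mem X)) (@enum_val _ (mem Y)) A.

(* [conform_mx] casts the submatrix to a square matrix type when
   #|X| = #|Y| (see [minorE]); otherwise it returns the default matrix 0,
   a junk case. *)
Definition minor (R : comPzRingType) (n : nat) (A : 'M[R]_n)
    (X Y : {set 'I_n}) : R :=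
  \det (conform_mx (0 : 'M[R]_#|X|) (submx_on A X Y)).

Definition totally_nonnegative (R : realType) (n : nat) (A : 'M[R]_n) : Prop :=
  forall X Y : {set 'I_n}, #|X| = #|Y| -> 0 <= minor A X Y.

Lemma enum_val_ltn (n : nat) (X : {set 'I_n}) (i j : 'I_#|X|) :
  (i < j)%N -> (enum_val i < enum_val j)%N.
Proof.
have sX : sorted ltn [seq val x | x <- enum X].
  rewrite sorted_map /enum_mem; apply: sorted_filter.
    by move=> y x z; apply: ltn_trans.
  by rewrite -enumT -sorted_map val_enum_ord iota_ltn_sorted.
have sz (k : 'I_#|X|) : (k < size (enum X))%N by rewrite -cardE.
have e (k : 'I_#|X|) :
    nat_of_ord (enum_val k) = nth 0%N [seq val x | x <- enum X] k.
  by rewrite (nth_map (enum_val i)) // -enum_val_nth.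
by rewrite !e; apply: (sorted_ltn_nth ltn_trans) => //; rewrite inE size_map.
Qed.

Lemma minorE (R : comPzRingType) (n : nat) (A : 'M[R]_n) (X Y : {set 'I_n})
    (e : #|X| = #|Y|) :
  minor A X Y =
  \det (\matrix_(i < #|X|, j < #|X|) A (enum_val i) (enum_val (cast_ord e j))).
Proof.
rewrite /minor /submx_on; congr (\det _).
have -> : mxsub (@enum_val _ (mem X)) (@enum_val _ (mem Y)) A =
  castmx (erefl, e) (\matrix_(i < #|X|, j < #|X|)
     A (enum_val i) (enum_val (cast_ord e j))).
  by apply/matrixP => i j; rewrite castmxE !mxE cast_ord_id cast_ordKV.
by case: _ / e (\matrix_(i, j) _) => B; rewrite castmx_id conform_mx_id.
Qed.

(* Main.v *)
(** Adding a nonnegative multiple of a column to an adjacent column only adds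
    nonnegative terms to the signed partial sums: each new partial sum is an old
    one plus partial sums for a modified [T], or plus a product of two minors.
    Conversely, Neville elimination writes a totally nonnegative matrix [A] as
    the result of such an operation on a totally nonnegative matrix with strictly
    smaller support, unless the pivot column vanishes or [A] is diagonal; in these
    two cases all the products in the sum are zero.  That an elimination step
    preserves total nonnegativity follows by induction on the size of the minors
    from a three-term Pluecker relation. *)

Require Import Defs.
From HB Require Import structures.
From mathcomp Require Import all_boot all_order all_algebra.
From mathcomp Require Import reals.
From mathcomp Require Import perm zify ring.

Set Implicit Arguments.
Unset Strict Implicit.
Unset Printing Implicit Defensive.

Import Order.TTheory GRing.Theory Num.Theory.

Local Open Scope ring_scope.

(** * Ranks and increasing enumerations of index sets *)

(** Also meaningful for [j] outside [U], where it is the position at which [j] would be inserted;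
    Laplace signs are powers with this exponent, free of casts. *)
Definition rank_in (n : nat) (U : {set 'I_n}) (j : 'I_n) : nat :=
  #|[set u in U | (u < j)%N]|.

Lemma rank_in_enum_val (n : nat) (U : {set 'I_n}) (k : 'I_#|U|) :
  rank_in U (enum_val k) = k.
Proof.
rewrite /rank_in; transitivity #|[set i : 'I_#|U| | (i < k)%N]|.
  rewrite -(card_imset _ (@enum_val_inj _ (mem U))); apply: eq_card => u.
  apply/idP/imsetP => [|[i]]; rewrite !inE.
    move=> /andP[uU]; rewrite -(enum_rankK_in uU uU) => lt_uk.
    exists (enum_rank_in uU u) => //; rewrite inE ltnNge leq_eqVlt.
    apply/negP => /orP[/eqP/val_inj e|/enum_val_ltn]; last by lia.
    by move: lt_uk; rewrite e ltnn.
  by move=> lt_ik ->; rewrite enum_valP enum_val_ltn.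
rewrite -sum1dep_card -(big_ord_widen _ (fun=> 1%N)) ?(ltnW (ltn_ord k)) //.
by rewrite sum1_card card_ord.
Qed.

Lemma rank_in_ltn (n : nat) (U : {set 'I_n}) (x y : 'I_n) :
  x \in U -> (rank_in U x < rank_in U y)%N = (x < y)%N.
Proof.
move=> xU; have mono (u v : 'I_n) : (u <= v)%N -> (rank_in U u <= rank_in U v)%N.
  move=> le_uv; apply/subset_leq_card/subsetP => w; rewrite !inE.
  by case/andP=> -> /=; lia.
have [lt_xy|le_yx] := ltnP x y; last by apply/negbTE; rewrite -leqNgt mono.
apply/proper_card/properP; split.
  by apply/subsetP => w; rewrite !inE => /andP[-> /=]; lia.
by exists x; rewrite !inE xU //= ltnn.
Qed.

Lemma rank_in_inj (n : nat) (U : {set 'I_n}) :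
  {in U &, injective (rank_in U)}.
Proof.
move=> x y xU yU e; have := rank_in_ltn y xU; have := rank_in_ltn x yU.
rewrite e ltnn => /esym/negbT + /esym/negbT; rewrite -!leqNgt => le_xy le_yx.
by apply/val_inj/anti_leq; rewrite le_xy.
Qed.

Lemma rank_in_setU1 (n : nat) (U : {set 'I_n}) (j v : 'I_n) :
  j \notin U -> rank_in (j |: U) v = (rank_in U v + (j < v))%N.
Proof.
move=> jU; rewrite /rank_in addnC; have [lt_jv|le_vj] := ltnP j v.
  transitivity #|j |: [set u in U | (u < v)%N]|.
    by apply: eq_card => u; rewrite !inE; case: eqP => [->|].
  by rewrite cardsU1 inE (negbTE jU).
apply: eq_card => u; rewrite !inE.
by case: eqP => [->|] //=; rewrite (negbTE jU) ltnNge le_vj.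
Qed.

Lemma rank_in_setD1 (n : nat) (U : {set 'I_n}) (j v : 'I_n) :
  j \in U -> rank_in U v = (rank_in (U :\ j) v + (j < v))%N.
Proof. by move=> jU; rewrite -rank_in_setU1 ?setD1K // !inE eqxx. Qed.

(** When [#|U| = r] this characterizes the increasing enumeration of [U]; keeping [r] free avoids
    casts between types ['I_#|U|]. *)
Definition enumerates (n r : nat) (U : {set 'I_n}) (f : 'I_r -> 'I_n) : Prop :=
  forall i, f i \in U /\ rank_in U (f i) = i.

Lemma enumerates_exists (n r : nat) (U : {set 'I_n}) :
  #|U| = r -> exists f : 'I_r -> 'I_n, enumerates U f.
Proof.
move=> <-; exists enum_val => i.
by split; [exact: enum_valP | exact: rank_in_enum_val].
Qed.

Lemma enumerates_onto (n r : nat) (U : {set 'I_n}) (f : 'I_r -> 'I_n) x :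
  #|U| = r -> enumerates U f -> x \in U -> exists i, x = f i.
Proof.
move=> Ur fU xU.
have lt_xr : (rank_in U x < r)%N.
  rewrite -Ur; apply/proper_card/properP; split.
    by apply/subsetP => u; rewrite inE => /andP[].
  by exists x; rewrite // inE ltnn andbF.
exists (Ordinal lt_xr).
by have [fxU e] := fU (Ordinal lt_xr); apply: (rank_in_inj xU fxU).
Qed.

(** Deleting [f i] lowers by one exactly the ranks above [i], just as [lift i] skips [i]; this
    matches [row'] and [col'] in cofactors. *)
Lemma enumerates_lift (n r : nat) (U : {set 'I_n}) (f : 'I_r.+1 -> 'I_n) i :
  enumerates U f -> enumerates (U :\ f i) (f \o lift i).
Proof.
move=> fU j; have [fiU fiE] := fU i; have [fjU fjE] := fU (lift i j).
split=> /=.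
  rewrite !inE fjU andbT; apply/eqP => e; move: fjE; rewrite e fiE => /eqP.
  by rewrite (inj_eq val_inj) (negbTE (neq_lift _ _)).
have := rank_in_ltn (f (lift i j)) fiU.
rewrite fiE fjE => lt_f; have := rank_in_setD1 (f (lift i j)) fiU.
by rewrite fjE -lt_f /= /bump; case: leqP => /=; lia.
Qed.

Lemma minor_enumerates (R : comPzRingType) (n r : nat) (A : 'M[R]_n)
    (X Y : {set 'I_n}) (f g : 'I_r -> 'I_n) :
  #|X| = r -> #|Y| = r -> enumerates X f -> enumerates Y g ->
  minor A X Y = \det (mxsub f g A).
Proof.
move=> Xr Yr fX gY; have XY : #|X| = #|Y| by rewrite Xr.
rewrite (minorE A XY); case: r / Xr f g Yr fX gY => f g _ fX gY.
congr (\det _); apply/matrixP => i j; rewrite !mxE; congr (A _ _).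
  by apply: (rank_in_inj (U := X)); rewrite ?rank_in_enum_val ?enum_valP //; case: (fX i).
apply: (rank_in_inj (U := Y)); rewrite ?rank_in_enum_val ?enum_valP //; case: (gY j) => //.
Qed.

Lemma big_enumerates (R : nmodType) (n r : nat) (U : {set 'I_n})
    (f : 'I_r -> 'I_n) (F : 'I_n -> R) :
  #|U| = r -> enumerates U f -> \sum_(j in U) F j = \sum_(k < r) F (f k).
Proof.
move=> Ur fU; have f_inj : injective f.
  by move=> x y e; apply: val_inj; rewrite /= -(fU x).2 -(fU y).2 e.
transitivity (\sum_(j in f @: setT) F j).
  apply: eq_bigl => j; apply/idP/imsetP => [jU|[k _ ->]]; last by case: (fU k).
  by have [k ->] := enumerates_onto Ur fU jU; exists k.
rewrite big_imset /=; last by move=> x y _ _; apply: f_inj.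
by apply: eq_bigl => k; rewrite inE.
Qed.

(** * Laplace expansion of minors *)

Lemma minor_congr (R : comPzRingType) (n : nat) (A B : 'M[R]_n)
    (X Y : {set 'I_n}) :
  #|X| = #|Y| -> (forall i j, i \in X -> j \in Y -> A i j = B i j) ->
  minor A X Y = minor B X Y.
Proof.
move=> XY AB; rewrite !(minorE _ XY); congr (\det _); apply/matrixP => i j.
by rewrite !mxE AB ?enum_valP.
Qed.

Lemma minor_tr (R : comPzRingType) (n : nat) (A : 'M[R]_n) (X Y : {set 'I_n}) :
  #|X| = #|Y| -> minor A^T X Y = minor A Y X.
Proof.
move=> XY; have [f fX] := enumerates_exists XY.
have [g gY] := enumerates_exists (erefl #|Y|).
rewrite (minor_enumerates _ XY erefl fX gY) (minor_enumerates _ erefl XY gY fX).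
by rewrite -det_tr; congr (\det _); apply/matrixP => i j; rewrite !mxE.
Qed.

(** For [i] outside [X] this is expansion along row [i]; for [i] in [X] it expands a determinant in
    which row [i] occurs twice. *)
Lemma minor_laplace_row (R : comPzRingType) (n : nat) (A : 'M[R]_n)
    (X Y : {set 'I_n}) (i : 'I_n) :
  #|Y| = #|X|.+1 ->
  \sum_(j in Y) (-1) ^+ rank_in Y j * A i j * minor A X (Y :\ j) =
  if i \in X then 0 else (-1) ^+ rank_in X i * minor A (i |: X) Y.
Proof.
move=> YX; have [g gY] := enumerates_exists YX.
rewrite (big_enumerates _ YX gY).
have YD k : #|Y :\ g k| = #|X|.
  by apply/eqP; rewrite -eqSS -YX (cardsD1 (g k) Y) (gY k).1.
have [iX|iX] := ifPn.
  have [f fX] := enumerates_exists (erefl #|X|).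
  have [k0 e0] := enumerates_onto erefl fX iX.
  (* [h] puts row [i] on top of the rows of [X]. *)
  pose h k := if unlift ord0 k is Some k' then f k' else i.
  transitivity (\det (mxsub h g A)).
    rewrite (expand_det_row _ ord0); apply: eq_bigr => k _.
    rewrite (gY k).2 mxE {1}/h unlift_none /cofactor add0n.
    rewrite (minor_enumerates _ erefl (YD k) fX (enumerates_lift k gY)).
    have -> : mxsub f (g \o lift k) A = row' ord0 (col' k (mxsub h g A)).
      by apply/matrixP => x y; rewrite !mxE /h liftK.
    ring.
  apply: (@determinant_alternate _ _ _ ord0 (lift ord0 k0)) => // k.
  by rewrite !mxE /h unlift_none liftK e0.
have iXr : #|i |: X| = #|X|.+1 by rewrite cardsU1 iX.
have [f fX] := enumerates_exists iXr.
have [k0 e0] := enumerates_onto iXr fX (setU11 i X).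
have <- : k0 = rank_in X i :> nat.
  by rewrite -(fX k0).2 -e0 rank_in_setU1 // ltnn addn0.
rewrite (minor_enumerates _ iXr YX fX gY) (expand_det_row _ k0) mulr_sumr.
apply: eq_bigr => k _; rewrite (gY k).2 mxE -e0 /cofactor.
have fXk := enumerates_lift k0 fX; rewrite -e0 setU1K // in fXk.
rewrite (minor_enumerates _ erefl (YD k) fXk (enumerates_lift k gY)).
have -> : mxsub (f \o lift k0) (g \o lift k) A = row' k0 (col' k (mxsub f g A)).
  by apply/matrixP => x y; rewrite !mxE.
(* The row sign of the cofactor cancels against the factor with exponent [k0]. *)
have := signrMK k0 ((-1) ^+ k : R); rewrite exprD => {1}<-.
ring.
Qed.

Lemma minor_laplace_col (R : comPzRingType) (n : nat) (A : 'M[R]_n)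
    (X Y : {set 'I_n}) (j : 'I_n) :
  #|X| = #|Y|.+1 ->
  \sum_(i in X) (-1) ^+ rank_in X i * A i j * minor A (X :\ i) Y =
  if j \in Y then 0 else (-1) ^+ rank_in Y j * minor A X (j |: Y).
Proof.
move=> XY; transitivity
    (\sum_(i in X) (-1) ^+ rank_in X i * A^T j i * minor A^T Y (X :\ i)).
  apply: eq_bigr => i iX; rewrite mxE minor_tr //.
  by apply/eqP; rewrite -eqSS -XY (cardsD1 i X) iX.
rewrite minor_laplace_row //; case: ifPn => // jY.
by rewrite minor_tr // cardsU1 jY XY.
Qed.

Lemma minor_row0 (R : comPzRingType) (n : nat) (A : 'M[R]_n)
    (X Y : {set 'I_n}) (i : 'I_n) :
  #|X| = #|Y| -> i \in X -> (forall j, j \in Y -> A i j = 0) ->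
  minor A X Y = 0.
Proof.
move=> XY iX A0; have := @minor_laplace_row _ _ A (X :\ i) Y i.
rewrite -XY (cardsD1 i) iX => /(_ erefl); rewrite !inE eqxx setD1K //=.
rewrite big1 => [/esym/(canRL (signrMK _))|j jY]; first by rewrite mulr0.
by rewrite A0 // mulr0 mul0r.
Qed.

Lemma minor_col0 (R : comPzRingType) (n : nat) (A : 'M[R]_n)
    (X Y : {set 'I_n}) (j : 'I_n) :
  #|X| = #|Y| -> j \in Y -> (forall i, i \in X -> A i j = 0) ->
  minor A X Y = 0.
Proof.
move=> XY jY A0; rewrite -minor_tr //; apply: (minor_row0 (i := j)) => // i iX.
by rewrite mxE A0.
Qed.

(** * Column operations between adjacent columns *)

Definition adjacent (n : nat) (a b : 'I_n) : bool :=
  (val a == (val b).+1) || (val b == (val a).+1).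

Lemma adjacent_neq (n : nat) (a b : 'I_n) : adjacent a b -> a != b.
Proof. by rewrite /adjacent -val_eqE /=; lia. Qed.

Lemma adjacentE (n : nat) (a b u : 'I_n) :
  adjacent a b -> u != a -> u != b -> (u < a)%N = (u < b)%N.
Proof. by rewrite /adjacent -!val_eqE /=; lia. Qed.

Lemma rank_in_adjacent (n : nat) (U : {set 'I_n}) (a b : 'I_n) :
  adjacent a b -> a \notin U -> b \notin U -> rank_in U a = rank_in U b.
Proof.
move=> ab aU bU; apply: eq_card => u; rewrite !inE; case: (boolP (u \in U)) => //= uU.
by apply: adjacentE => //; [apply: contraNneq aU => <- | apply: contraNneq bU => <-].
Qed.

Definition coladd (R : comPzRingType) (n : nat) (a b : 'I_n) (c : R)
    (A : 'M[R]_n) : 'M[R]_n :=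
  \matrix_(i, j) (if j == b then A i b + c * A i a else A i j).

(** By linearity in column [b], the extra term is the minor with [b] replaced by [a]; it vanishes if
    [a] already occurs in [Y]. Adjacency keeps the replaced column in its position, so no sign
    appears. *)
Lemma minor_coladd (R : comPzRingType) (n : nat) (A : 'M[R]_n) (a b : 'I_n)
    (c : R) (X Y : {set 'I_n}) :
  adjacent a b -> #|X| = #|Y| ->
  minor (coladd a b c A) X Y = minor A X Y +
    (if (b \in Y) && (a \notin Y) then c * minor A X (a |: Y :\ b) else 0).
Proof.
move=> ab XY; have [bY|bY] /= := boolP (b \in Y); last first.
  rewrite addr0; apply: minor_congr => // i j _ jY; rewrite mxE ifN //.
  by apply: contraNneq bY => <-.
have neq_ab := adjacent_neq ab.
set V := Y :\ b; have bV : b \notin V by rewrite !inE eqxx.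
have YV : Y = b |: V by rewrite setD1K.
have XV : #|X| = #|V|.+1 by rewrite XY YV cardsU1 bV.
have aYV : (a \in Y) = (a \in V) by rewrite !inE neq_ab.
have := minor_laplace_col (coladd a b c A) b XV.
rewrite (negbTE bV) -YV => E.
have := minor_laplace_col A b XV; rewrite (negbTE bV) -YV => EA.
have := minor_laplace_col A a XV; rewrite -aYV => Ea.
apply: (can_inj (signrMK (rank_in V b))); rewrite -E mulrDr -EA.
transitivity (\sum_(i in X) (-1) ^+ rank_in X i * A i b * minor A (X :\ i) V +
   c * \sum_(i in X) (-1) ^+ rank_in X i * A i a * minor A (X :\ i) V).
  rewrite mulr_sumr -big_split /=; apply: eq_bigr => i iX.
  rewrite mxE eqxx (@minor_congr _ _ _ A).
  - ring.
  - by apply/eqP; rewrite -eqSS -XV (cardsD1 i X) iX.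
  - move=> x y _ yV; rewrite mxE ifN //.
    by apply: contraNneq bV => <-.
rewrite Ea; case: ifPn => //= aY; first by rewrite !mulr0.
rewrite (rank_in_adjacent ab) //; last by rewrite -aYV.
by congr (_ + _); ring.
Qed.

(** * The three-term Pluecker relation and total nonnegativity under Neville elimination *)

Lemma minor_plucker3 (R : comPzRingType) (n : nat) (A : 'M[R]_n)
    (X Y : {set 'I_n}) (i x y z : 'I_n) :
  i \in X -> #|X| = #|Y|.+2 -> x \notin Y -> y \notin Y -> z \notin Y ->
  (x < y < z)%N ->
  minor A X (x |: (z |: Y)) * minor A (X :\ i) (y |: Y) =
  minor A X (y |: (z |: Y)) * minor A (X :\ i) (x |: Y) +
  minor A X (x |: (y |: Y)) * minor A (X :\ i) (z |: Y).
Proof.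
move=> iX XY xY yY zY /andP[lt_xy lt_yz]; set Z := x |: (y |: (z |: Y)).
have neq_xy : x != y by rewrite -val_eqE /=; lia.
have neq_yz : y != z by rewrite -val_eqE /=; lia.
have neq_xz : x != z by rewrite -val_eqE /=; lia.
have yzY : y \notin z |: Y by rewrite !inE negb_or neq_yz.
have xyzY : x \notin y |: (z |: Y) by rewrite !inE !negb_or neq_xy neq_xz.
have ZX : #|Z| = #|X|.+1 by rewrite XY !cardsU1 xyzY yzY zY.
have XiY : #|X :\ i| = #|Y|.+1.
  by apply/eqP; rewrite -eqSS -XY (cardsD1 i X) iX.
(* [F j] is the minor with columns [Y] and [j], up to sign, and vanishes for [j]
   in [Y]; as a combination of rows in [X] it is orthogonal to the vector of
   signed maximal minors of the rows [X] and columns [Z]. *)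
pose F j := \sum_(k in X :\ i)
  (-1) ^+ rank_in (X :\ i) k * A k j * minor A (X :\ i :\ k) Y.
have FE j : F j = if j \in Y then 0 else
    (-1) ^+ rank_in Y j * minor A (X :\ i) (j |: Y) by exact: minor_laplace_col.
have : \sum_(j in Z) (-1) ^+ rank_in Z j * F j * minor A X (Z :\ j) = 0.
  transitivity (\sum_(k in X :\ i) (-1) ^+ rank_in (X :\ i) k *
      minor A (X :\ i :\ k) Y *
      \sum_(j in Z) (-1) ^+ rank_in Z j * A k j * minor A X (Z :\ j)).
    under eq_bigr do rewrite /F mulr_sumr mulr_suml.
    rewrite exchange_big /=; apply: eq_bigr => k _; rewrite mulr_sumr.
    by apply: eq_bigr => j _; ring.
  rewrite big1 // => k /setD1P[_ kX].
  by rewrite minor_laplace_row // kX mulr0.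
rewrite {1}/Z !big_setU1 //= big1 => [|j jY]; last by rewrite FE jY; ring.
rewrite !FE (negbTE xY) (negbTE yY) (negbTE zY).
have -> : Z :\ x = y |: (z |: Y) by rewrite setU1K.
have -> : Z :\ y = x |: (z |: Y).
  by rewrite /Z setUCA setU1K // !inE !negb_or eq_sym neq_xy neq_yz.
have -> : Z :\ z = x |: (y |: Y).
  rewrite /Z [y |: _]setUCA setUCA setU1K //.
  by rewrite !inE !negb_or ![z == _]eq_sym neq_xz neq_yz.
(* The ranks of [x], [y], [z] in [Z] exceed those in [Y] by 0, 1, 2, so the three remaining terms
   carry the signs +, -, +. *)
rewrite !rank_in_setU1 // !ltnn lt_xy lt_yz (ltn_trans lt_xy lt_yz).
rewrite [(y < x)%N]ltnNge [(z < x)%N]ltnNge [(z < y)%N]ltnNge.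
rewrite (ltnW lt_xy) (ltnW lt_yz) (ltnW (ltn_trans lt_xy lt_yz)) /=.
have sK k (w : R) : (-1) ^+ k * ((-1) ^+ k * w) = w by exact: signrMK.
rewrite !addn0 !addn1 !exprS !mulN1r opprK !mulNr !sK addr0 => e.
apply/eqP; rewrite -subr_eq0 -oppr_eq0; apply/eqP; rewrite -[RHS]e; ring.
Qed.

(* Both directions of the index order are needed: column operations from left to
   right clear the entries above the diagonal, those from right to left the
   entries below it. *)
Definition before (n : nat) (d : bool) (x y : 'I_n) : bool :=
  if d then (x < y)%N else (y < x)%N.

Lemma rank_in_before (n : nat) (d : bool) (U : {set 'I_n}) (x : 'I_n) :
  x \notin U -> (forall u, u \in U -> ~~ before d u x) ->
  rank_in U x = if d then 0%N else #|U|.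
Proof.
move=> xU Ux; rewrite /rank_in; case: d Ux => /= Ux.
  apply/eqP; rewrite cards_eq0; apply/eqP/setP => u; rewrite !inE.
  by apply/negbTE/andP => -[/Ux/negP].
apply: eq_card => u; rewrite !inE; case: (boolP (u \in U)) => //= uU.
have := Ux u uU; have : u != x by apply: contraNneq xU => <-.
by rewrite -val_eqE /=; lia.
Qed.

Lemma minor1 (R : comPzRingType) (n : nat) (A : 'M[R]_n) (i j : 'I_n) :
  minor A [set i] [set j] = A i j.
Proof.
have enum1 (x : 'I_n) : enumerates [set x] (fun _ : 'I_1 => x).
  move=> k; rewrite set11 ord1; split=> //; apply/eqP; rewrite cards_eq0.
  by apply/eqP/setP => u; rewrite !inE; case: eqP => // ->; rewrite ltnn.
rewrite (minor_enumerates _ (cards1 i) (cards1 j) (enum1 i) (enum1 j)).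
by rewrite det_mx11 mxE.
Qed.

Lemma totally_nonnegative_ge0 (R : realType) (n : nat) (A : 'M[R]_n) i j :
  totally_nonnegative A -> 0 <= A i j.
Proof. by move=> tnA; rewrite -minor1 tnA // !cards1. Qed.

(** A row of [X] before [i] makes both minors zero. Otherwise only [a] and [b] contribute when row
    [i] is expanded over the columns [a], [b], [C], so the difference of the two sides is a minor
    with row [i] added to [X], or 0 if [i] lies in [X]. *)
Lemma minor_neville_le_base (R : realType) (n : nat) (A : 'M[R]_n) (d : bool)
    (i a b : 'I_n) (X C : {set 'I_n}) :
  totally_nonnegative A -> adjacent a b -> before d a b ->
  (forall i' j, before d i' i -> ~~ before d j a -> A i' j = 0) ->
  (forall j, before d b j -> A i j = 0) ->
  a \notin C -> b \notin C -> #|X| = #|C|.+1 ->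
  (forall c, c \in C -> ~~ before d c a) ->
  A i b * minor A X (a |: C) <= A i a * minor A X (b |: C).
Proof.
move=> tnA ab dab A0 Ai0 aC bC XC Ca.
have neq_ab := adjacent_neq ab.
have dba : ~~ before d b a by case: (d) dab => /=; lia.
have [/existsP[x /andP[xX dxi]]|/existsPn noX] := boolP [exists x in X, before d x i].
  rewrite !(@minor_row0 _ _ _ X _ x) ?mulr0 //.
  - by rewrite cardsU1 bC XC.
  - by move=> j /setU1P[->|/Ca]; apply: A0.
  - by rewrite cardsU1 aC XC.
  - by move=> j /setU1P[->|/Ca]; apply: A0 => //; case: (d) => /=; rewrite ltnn.
have {}noX x : x \in X -> ~~ before d x i.
  by move=> xX; have := noX x; rewrite xX.
set Y := a |: (b |: C); have abC : a \notin b |: C by rewrite !inE negb_or neq_ab.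
have YX : #|Y| = #|X|.+1 by rewrite XC !cardsU1 abC bC.
have := minor_laplace_row A i YX.
rewrite {1}/Y !big_setU1 //= big1 => [|j jC]; last first.
  rewrite Ai0 ?mulr0 ?mul0r //; have := Ca j jC.
  have : j != a by apply: contraNneq aC => <-.
  have : j != b by apply: contraNneq bC => <-.
  by move: ab dab; rewrite /adjacent -!val_eqE; case: (d) => /=; lia.
have -> : Y :\ a = b |: C by rewrite setU1K.
have -> : Y :\ b = a |: C by rewrite /Y setUCA setU1K // !inE negb_or eq_sym neq_ab.
have rC : rank_in C a = if d then 0%N else #|C| by apply: rank_in_before.
have rYa : rank_in Y a = (rank_in C a + ~~ d)%N.
  rewrite !rank_in_setU1 // ltnn addn0; congr (_ + _)%N.
  by move: dab; case: (d) => /=; lia.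
have rYb : rank_in Y b = (rank_in C a + d)%N.
  rewrite !rank_in_setU1 // ltnn addn0 (rank_in_adjacent ab) //.
  by congr (_ + _)%N; move: dab; case: (d) => /=; lia.
rewrite rYa rYb addr0 -subr_ge0; set t := rank_in C a.
have sgn : (-1) ^+ (t + d) = - (-1) ^+ (t + ~~ d) :> R.
  by case: (d) => /=; rewrite addn0 addn1 exprS mulN1r ?opprK.
rewrite sgn !mulNr -!mulrA -mulrBr.
have [iX|iX] := ifPn.
  by move=> /eqP; rewrite mulf_eq0 signr_eq0 /= => /eqP ->.
(* The sign of row [i] equals that of column [a]: both exponents are 0 if [d] holds, and both are
   [#|C| + 1] otherwise. *)
rewrite (rank_in_before iX noX) /t rC.
rewrite (_ : (if d then 0 else #|X|)%N = ((if d then 0 else #|C|) + ~~ d)%N).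
  by move=> /(can_inj (signrMK _)) ->; rewrite tnA // YX cardsU1 iX.
by case: (d) => //=; rewrite XC addn1.
Qed.

(** Induction on the size of [C]: a column [c] of [C] before [a] is removed together with a row [k]
    by the Pluecker relation for [a], [b], [c]. *)
Lemma minor_neville_le (R : realType) (n : nat) (A : 'M[R]_n) (d : bool)
    (i a b : 'I_n) (X C : {set 'I_n}) :
  totally_nonnegative A -> adjacent a b -> before d a b ->
  (forall i' j, before d i' i -> ~~ before d j a -> A i' j = 0) ->
  (forall j, before d b j -> A i j = 0) ->
  a \notin C -> b \notin C -> #|X| = #|C|.+1 ->
  A i b * minor A X (a |: C) <= A i a * minor A X (b |: C).
Proof.
move=> tnA ab dab A0 Ai0; move: {2}#|C| (erefl #|C|) => m.
have neq_ab := adjacent_neq ab.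
elim: m C X => [|m IHm] C X Cm aC bC XC.
  by apply: (@minor_neville_le_base _ _ _ d) => // c; rewrite (cards0_eq Cm) inE.
have [/existsP[c /andP[cC dca]]|/existsPn noC] := boolP [exists c in C, before d c a];
  last by apply: (@minor_neville_le_base _ _ _ d) => // c cC; have := noC c; rewrite cC.
set V := C :\ c; have cV : c \notin V by rewrite !inE eqxx.
have CV : C = c |: V by rewrite setD1K.
have Vm : #|V| = m by move: Cm; rewrite CV cardsU1 cV => -[].
have aV : a \notin V by rewrite !inE negb_and aC orbT.
have bV : b \notin V by rewrite !inE negb_and bC orbT.
have tn_ge0 (Z W : {set 'I_n}) : #|Z| = #|W| -> 0 <= minor A Z W by apply: tnA.
have XaC : #|X| = #|a |: C| by rewrite cardsU1 aC XC.
have XbC : #|X| = #|b |: C| by rewrite cardsU1 bC XC.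
have [Ma0|Ma0] := eqVneq (minor A X (a |: C)) 0.
  by rewrite Ma0 mulr0 mulr_ge0 ?tn_ge0 // totally_nonnegative_ge0.
have XaV : #|X| = #|a |: V|.+1 by rewrite cardsU1 aV XC Cm Vm.
(* Choosing the row to delete by Laplace expansion of a nonzero minor makes the
   division by [minor A (X :\ k) (a |: V)] legitimate. *)
have [k kX mk] : exists2 k, k \in X & minor A (X :\ k) (a |: V) != 0.
  apply/exists_inP; apply: contraNT Ma0 => /exists_inPn m0.
  have := minor_laplace_col A c XaV.
  have caV : c \notin a |: V.
    by rewrite !inE negb_or eqxx andbT; apply: contraNneq aC => <-.
  rewrite (negbTE caV) setUCA -CV big1 => [/esym/eqP|x xX].
    by rewrite mulf_eq0 signr_eq0.
  by have := m0 x xX; rewrite negbK => /eqP ->; rewrite mulr0.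
have XkD (W : {set 'I_n}) : #|X| = #|W|.+1 -> #|X :\ k| = #|W|.
  by move=> e; apply/eqP; rewrite -eqSS -e (cardsD1 k X) kX.
have mk_gt0 : 0 < minor A (X :\ k) (a |: V) by rewrite lt0r mk tn_ge0 ?(XkD _ XaV).
have XV : #|X| = #|V|.+2 by rewrite XC Cm Vm.
have XkV : #|X :\ k| = #|V|.+1 by rewrite (XkD _ XaV) cardsU1 aV.
have ihV := IHm V (X :\ k) Vm aV bV XkV.
rewrite -(ler_pM2r mk_gt0).
(* Since [a] lies between [c] and [b], the product with [a] on the smaller minor is the one that
   splits into two nonnegative products; the induction hypothesis bounds the first, the second is
   dropped. *)
have : minor A X (b |: C) * minor A (X :\ k) (a |: V) =
    minor A X (a |: C) * minor A (X :\ k) (b |: V) +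
    minor A X (a |: (b |: V)) * minor A (X :\ k) (c |: V).
  rewrite CV; case: (d) dab dca => /= dab dca.
    have acb : (c < a < b)%N by apply/andP.
    have := minor_plucker3 A kX XV cV aV bV acb.
    by rewrite [c |: (b |: V)]setUCA [c |: (a |: V)]setUCA => ->; rewrite addrC.
  have bac : (b < a < c)%N by apply/andP.
  have := minor_plucker3 A kX XV bV aV cV bac.
  by rewrite [a |: (c |: V)]setUCA [b |: (a |: V)]setUCA => ->; rewrite addrC.
move=> pl; rewrite -[leRHS]mulrA pl mulrDr.
apply: (@le_trans _ _ (A i a * (minor A X (a |: C) * minor A (X :\ k) (b |: V)))).
  rewrite mulrAC [leRHS]mulrCA mulrC ler_wpM2l ?tn_ge0 //.
rewrite lerDl !mulr_ge0 ?(totally_nonnegative_ge0 _ _ tnA) ?tn_ge0 //.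
  by rewrite XV !cardsU1 bV in_setU1 negb_or neq_ab aV.
by rewrite XkV cardsU1 cV.
Qed.

(** The coefficient clears the entry [(i, b)]. The minors that change stay nonnegative by
    [minor_neville_le], divided by [A i a]. *)
Lemma totally_nonnegative_neville (R : realType) (n : nat) (A : 'M[R]_n)
    (d : bool) (i a b : 'I_n) :
  totally_nonnegative A -> adjacent a b -> before d a b ->
  (forall i' j, before d i' i -> ~~ before d j a -> A i' j = 0) ->
  (forall j, before d b j -> A i j = 0) -> A i a != 0 ->
  totally_nonnegative (coladd a b (- (A i b / A i a)) A).
Proof.
move=> tnA ab dab A0 Ai0 Aia X Y XY; rewrite minor_coladd //.
case: ifPn => [/andP[bY aY]|_]; last by rewrite addr0 tnA.
have XV : #|X| = #|Y :\ b|.+1 by rewrite XY (cardsD1 b Y) bY.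
have Aia_gt0 : 0 < A i a by rewrite lt0r Aia totally_nonnegative_ge0.
have aV : a \notin Y :\ b by rewrite !inE negb_and aY orbT.
have bV : b \notin Y :\ b by rewrite !inE eqxx.
have := minor_neville_le tnA ab dab A0 Ai0 aV bV XV.
rewrite setD1K // mulNr subr_ge0 => le_ab.
by rewrite mulrAC ler_pdivrMr // [leRHS]mulrC.
Qed.

(** One-by-one minors in [minor_neville_le] give [A i b * A k a <= A i a * A k b], whose right side
    is 0. *)
Lemma neville_col0 (R : realType) (n : nat) (A : 'M[R]_n)
    (d : bool) (i a b k : 'I_n) :
  totally_nonnegative A -> adjacent a b -> before d a b ->
  (forall i' j, before d i' i -> ~~ before d j a -> A i' j = 0) ->
  (forall j, before d b j -> A i j = 0) -> A i a = 0 -> A i b != 0 ->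
  A k a = 0.
Proof.
move=> tnA ab dab A0 Ai0 Aia Aib.
have Aib_gt0 : 0 < A i b by rewrite lt0r Aib totally_nonnegative_ge0.
have := @minor_neville_le _ _ A d i a b [set k] set0 tnA ab dab A0 Ai0.
rewrite !inE cards1 cards0 !setU0 !minor1 => /(_ isT isT erefl).
rewrite Aia mul0r pmulr_rle0 // => Aka.
by apply/le_anti; rewrite Aka totally_nonnegative_ge0.
Qed.

(** * Signed partial sums under column operations *)

(** The sum of the theorem with its outer sign moved inside. Indexing by the column [v] and its
    zero-based rank allows reindexing by a transposition of columns. *)
Definition partial_sum (R : realType) (n : nat) (A : 'M[R]_n) (S : {set 'I_n})
    (p : 'I_n) (l : nat) (T : {set 'I_n}) : R :=
  \sum_(v in ~: T | (rank_in (~: T) v < l)%N)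
     (-1) ^+ (1 + l + rank_in (~: T) v) *
     (minor A S (v |: T) * minor A [set~ p] [set~ v]).

(** Both minors of every product contain column [a]: the first through [T], the second because [v]
    differs from [a]. *)
Lemma partial_sum_coladd_mem (R : realType) (n : nat) (A : 'M[R]_n)
    (S T : {set 'I_n}) (p : 'I_n) (l : nat) (a b : 'I_n) (c : R) :
  adjacent a b -> #|S| = #|T|.+1 -> a \in T ->
  partial_sum (coladd a b c A) S p l T = partial_sum A S p l T.
Proof.
move=> ab ST aT; apply: eq_bigr => v /andP[]; rewrite inE => vT _.
have va : v != a by apply: contraNneq vT => ->.
rewrite !minor_coladd ?cardsU1 ?vT ?ST // ?cardsC1 //.
by rewrite !inE aT orbT /= andbF negbK (eq_sym a) (negbTE va) andbF !addr0.
Qed.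

Lemma rank_in_tperm (n : nat) (U : {set 'I_n}) (a b v : 'I_n) :
  adjacent a b -> a \in U -> b \notin U -> v \in U ->
  rank_in (b |: U :\ a) (tperm a b v) = rank_in U v.
Proof.
move=> ab aU bU vU; have bUa : b \notin U :\ a by rewrite !inE (negbTE bU) andbF.
have vb : v != b by apply: contraNneq bU => <-.
rewrite rank_in_setU1 // (rank_in_setD1 v aU); case: tpermP => [->|e|/eqP va _].
- by rewrite !ltnn !addn0 (rank_in_adjacent ab) // !inE eqxx.
- by rewrite e eqxx in vb.
- by congr (_ + nat_of_bool _)%N; move: ab va vb; rewrite /adjacent -!val_eqE /=; lia.
Qed.

(** In each product one factor changes: the second for [v = a], the first for every other [v]. The
    extra term is [c] times the product for [T'] at [tperm a b v], and this transposition preserves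
    ranks in the complements. *)
Lemma partial_sum_coladd_swap (R : realType) (n : nat) (A : 'M[R]_n)
    (S T : {set 'I_n}) (p : 'I_n) (l : nat) (a b : 'I_n) (c : R) :
  adjacent a b -> #|S| = #|T|.+1 -> a \notin T -> b \in T ->
  partial_sum (coladd a b c A) S p l T =
  partial_sum A S p l T + c * partial_sum A S p l (a |: T :\ b).
Proof.
move=> ab ST aT bT; set T' := a |: T :\ b.
have neq_ab : a != b by apply: contraNneq aT => ->.
have TC : ~: T' = b |: ~: T :\ a.
  apply/setP => u; rewrite !inE negb_or negb_and negbK.
  by have [->|] := eqVneq u b; rewrite ?andbT ?(eq_sym b) ?neq_ab.
have rankT v : v \in ~: T -> rank_in (~: T') (tperm a b v) = rank_in (~: T) v.
  by move=> vT; rewrite TC rank_in_tperm // !inE ?bT.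
rewrite {3}/partial_sum (reindex_inj (@perm_inj _ (tperm a b))) /=.
rewrite (eq_bigl (fun v => (v \in ~: T) && (rank_in (~: T) v < l)%N)) => [|v]; last first.
  have -> : (tperm a b v \in ~: T') = (v \in ~: T).
    by rewrite TC !inE; case: tpermP => [->|->|/eqP va /eqP vb];
      rewrite ?eqxx ?aT ?bT ?andbF ?orbF //= ?(negbTE va) ?(negbTE vb) // (negbTE neq_ab).
  by case: (boolP (v \in ~: T)) => //= vT; rewrite rankT.
rewrite mulr_sumr -big_split; apply: eq_bigr => v /andP[vT _] /=.
rewrite rankT // [X in _ + X]mulrCA -mulrDr; congr (_ * _); move: vT; rewrite inE => vT.
have vb : v != b by apply: contraNneq vT => ->.
rewrite !minor_coladd ?cardsU1 ?vT ?ST // ?cardsC1 //.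
rewrite !inE bT orbT (eq_sym b) vb negb_or aT andbT /= negbK.
case: tpermP => [->|e|/eqP va _].
- rewrite eqxx /= addr0 /T' setUCA setD1K // (_ : a |: [set~ a] :\ b = [set~ b]).
    by ring.
  by apply/setP => u; rewrite !inE; case: (eqVneq u a) => [->|]; rewrite ?andbT ?neq_ab.
- by rewrite e eqxx in vb.
- rewrite (eq_sym a) va (negbTE va) /= addr0.
  rewrite (_ : (v |: T) :\ b = v |: T :\ b) /T'.
    by rewrite setUCA; ring.
  by apply/setP => u; rewrite !inE; case: (eqVneq u v) => [->|]; rewrite ?vb.
Qed.

(** Only [v = a] (second factor) and [v = b] (first factor) gain a term, and both gain [y]. Their
    ranks are consecutive, so the two terms cancel unless the cut at [l] separates them. *)
Lemma partial_sum_coladd_notin (R : realType) (n : nat) (A : 'M[R]_n)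
    (S T : {set 'I_n}) (p : 'I_n) (l : nat) (a b : 'I_n) (c : R) :
  totally_nonnegative A -> 0 <= c ->
  adjacent a b -> #|S| = #|T|.+1 -> a \notin T -> b \notin T ->
  partial_sum A S p l T <= partial_sum (coladd a b c A) S p l T.
Proof.
move=> tnA c0 ab ST aT bT.
have neq_ab := adjacent_neq ab.
set y := c * (minor A S (a |: T) * minor A [set~ p] [set~ b]).
have y0 : 0 <= y.
  by rewrite !mulr_ge0 // tnA // ?cardsU1 ?aT ?ST // !cardsC1.
pose G v := if (rank_in (~: T) v < l)%N
  then (-1) ^+ (1 + l + rank_in (~: T) v) * y else 0.
have -> : partial_sum (coladd a b c A) S p l T =
    partial_sum A S p l T + (G a + G b).
  have -> : G a + G b = \sum_(v in ~: T)
      if (rank_in (~: T) v < l)%N then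
      (-1) ^+ (1 + l + rank_in (~: T) v) * (if v \in pred2 a b then y else 0) else 0.
    rewrite (bigD1 a) ?inE // (bigD1 b) /=; last by rewrite inE bT eq_sym neq_ab.
    rewrite !inE !eqxx orbT /=.
    rewrite big1 ?addr0 // => v /andP[/andP[_ /negbTE va] /negbTE vb].
    by rewrite !inE va vb /= mulr0 if_same.
  rewrite /partial_sum [in LHS]big_mkcondr [X in X + _]big_mkcondr -big_split /=.
  apply: eq_bigr => v; rewrite inE => vT; case: ifP => _; last by rewrite addr0.
  rewrite -mulrDr; congr (_ * _).
  rewrite !minor_coladd ?cardsU1 ?vT ?ST // ?cardsC1 //.
  rewrite !inE (negbTE aT) (negbTE bT) !orbF negbK.
  have [->|va] := eqVneq v a.
    rewrite andbF addr0 (eq_sym b) neq_ab /= (_ : a |: [set~ a] :\ b = [set~ b]).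
      by rewrite /y; ring.
    by apply/setP => u; rewrite !inE; case: (eqVneq u a) => [->|]; rewrite ?andbT ?neq_ab.
  have [->|vb] := eqVneq v b.
    rewrite /= addr0 setU1K //; by rewrite /y; ring.
  by rewrite /= !addr0.
rewrite lerDl /G; set W := ~: T :\ a :\ b.
have bU : b \in ~: T :\ a by rewrite !inE eq_sym neq_ab.
have aU : a \in ~: T :\ b by rewrite !inE neq_ab.
have aU' : a \in ~: T by rewrite inE.
have bU' : b \in ~: T by rewrite inE.
have Wab : rank_in W a = rank_in W b.
  by apply: rank_in_adjacent => //; rewrite !inE eqxx ?andbF.
rewrite (rank_in_setD1 a bU') (rank_in_setD1 a aU) ltnn addn0 setDDl setUC -setDDl.
rewrite (rank_in_setD1 b aU') (rank_in_setD1 b bU) ltnn addn0 -/W Wab.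
move: (rank_in W b) => r.
have main : 0 <= (if (r < l)%N then (-1) ^+ (1 + l + r) * y else 0) +
                 (if (r.+1 < l)%N then (-1) ^+ (1 + l + r.+1) * y else 0).
  have [lt_rl|le_lr] := ltnP r.+1 l.
    by rewrite (ltnW lt_rl) addnS [in X in _ + X]exprS mulN1r mulNr addrN.
  rewrite addr0; case: ltnP => // lt_rl.
  (* Only the lower rank is counted, so [r] is the last rank below [l] and [1 + l + r] is even. *)
  have -> : l = r.+1 by apply/anti_leq; rewrite le_lr.
  by rewrite -signr_odd !oddD /=; case: (odd r); rewrite mul1r.
case: (ltngtP a b) => e; rewrite ?addn0 ?addn1 //; first by rewrite addrC.
by case/eqP: neq_ab; apply: val_inj.
Qed.

(** Column [j] occurs in one factor of each product, the first if [v = j] and the second otherwise,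
    and neither factor uses row [p]. *)
Lemma partial_sum_eq0 (R : realType) (n : nat) (A : 'M[R]_n) (S T : {set 'I_n})
    (p j : 'I_n) (l : nat) :
  S \subset [set~ p] -> #|S| = #|T|.+1 -> (forall i, i != p -> A i j = 0) ->
  partial_sum A S p l T = 0.
Proof.
move=> /subsetP Sp ST A0; apply: big1 => v /andP[]; rewrite inE => vT _.
have [vE|vj] := eqVneq v j; last first.
  rewrite (@minor_col0 _ _ _ [set~ p] _ j) ?mulr0 ?cardsC1 //.
    by rewrite !inE eq_sym.
  by move=> i; rewrite !inE; apply: A0.
rewrite vE in vT *.
rewrite (@minor_col0 _ _ _ S _ j) ?mul0r ?mulr0 ?setU11 //.
  by rewrite cardsU1 vT ST.
by move=> i /Sp; rewrite !inE; apply: A0.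
Qed.

(** * Choice of a pivot and induction on the support *)

(** In direction [d], [i0] is the first row with a nonzero entry past the diagonal, [b] the last
    column with such an entry in it, and [a] the neighbour of [b] towards the diagonal. As [a] is
    not before [i0], earlier rows vanish from column [a] on. *)
Lemma ex_neville_pivot (R : nmodType) (n : nat) (A : 'M[R]_n) (d : bool)
    (i j : 'I_n) :
  before d i j -> A i j != 0 ->
  exists i0 a b, [/\ adjacent a b, before d a b, A i0 b != 0,
    forall i' j', before d i' i0 -> ~~ before d j' a -> A i' j' = 0 &
    forall j', before d b j' -> A i0 j' = 0].
Proof.
(* [key] turns either direction into the order of the natural numbers. *)
pose key (x : 'I_n) := if d then val x else (n - x)%N.
have keyE x y : before d x y = (key x < key y)%N.
  by rewrite /before /key; case: (d) => //; have := ltn_ord y; have := ltn_ord x; lia.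
move=> dij Aij; pose P (x : 'I_n) := [exists y, before d x y && (A x y != 0)].
have Pi : P i by apply/existsP; exists j; rewrite dij.
case: (arg_minnP key Pi) => i0 /existsP[j0 Pj0] min_i0.
pose Q (y : 'I_n) := before d i0 y && (A i0 y != 0).
case: (@arg_maxnP _ j0 Q key Pj0) => b /andP[dib Aib] max_b.
have [a [ab dab dia]] : exists a : 'I_n, [/\ adjacent a b, before d a b & ~~ before d a i0].
  move: dib; rewrite /before /adjacent; case: (d) => dib.
    have lt_b : (b.-1 < n)%N by have := ltn_ord b; lia.
    by exists (Ordinal lt_b) => /=; split; lia.
  have lt_b : (b.+1 < n)%N by have := ltn_ord i0; lia.
  by exists (Ordinal lt_b) => /=; split; lia.
exists i0, a, b; split=> // [i' j' di' aj'|j' dbj].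
  move: di' dia aj'; rewrite !keyE -!leqNgt => di' dia aj'; apply/eqP.
  apply: contraTT di' => Aij'; rewrite -leqNgt leqNgt; apply/negP => di'.
  suff /min_i0 : P i' by rewrite leqNgt di'.
  by apply/existsP; exists j'; rewrite Aij' keyE (leq_trans di') ?(leq_trans dia).
apply/eqP; move: dib dbj; rewrite !keyE => dib dbj.
apply: contraTT dbj => Aij'; rewrite -leqNgt leqNgt; apply/negP => dbj.
suff /max_b : Q j' by rewrite /= leqNgt dbj.
by rewrite /Q Aij' andbT keyE (ltn_trans dib).
Qed.

Lemma partial_sum_ge0 (R : realType) (n : nat) (A : 'M[R]_n) (S T : {set 'I_n})
    (p : 'I_n) (l : nat) :
  totally_nonnegative A -> S \subset [set~ p] -> #|S| = #|T|.+1 ->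
  0 <= partial_sum A S p l T.
Proof.
move=> tnA Sp; move: {2}_.+1 (ltnSn #|[set x | A x.1 x.2 != 0]|) => m.
(* [T] varies with [A], since the swap case calls the hypothesis at another set. *)
elim: m A T tnA => // m IHm A T tnA suppA ST.
have [/existsP[i /existsP[j /andP[neq_ij Aij]]]|/existsPn diagA] :=
    boolP [exists i, exists j, (i != j) && (A i j != 0)]; last first.
  (* [A] is diagonal, so column [p] vanishes outside row [p]. *)
  rewrite (@partial_sum_eq0 _ _ _ _ _ _ p) // => i ip.
  have /existsPn/(_ p) := diagA i; rewrite ip negbK => /eqP //.
(* The direction is the side of the diagonal on which the nonzero entry lies. *)
have dij : before (i < j)%N i j.
  by move: neq_ij; rewrite -val_eqE /before /=; case: ltngtP.
have [i0 [a [b [ab dab Aib A0 Ai0]]]] := ex_neville_pivot dij Aij.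
have [Aia|Aia] := eqVneq (A i0 a) 0.
  rewrite (@partial_sum_eq0 _ _ _ _ _ _ a) // => k _.
  exact: (neville_col0 k tnA ab dab A0 Ai0 Aia Aib).
set q := A i0 b / A i0 a.
have q_ge0 : 0 <= q by rewrite divr_ge0 ?totally_nonnegative_ge0.
pose B := coladd a b (- q) A.
have neq_ab := adjacent_neq ab.
have tnB : totally_nonnegative B by apply: totally_nonnegative_neville tnA ab dab A0 Ai0 Aia.
have AB : A = coladd a b q B.
  apply/matrixP => x y; rewrite !mxE (negbTE neq_ab).
  by case: eqP => [->|//]; rewrite eqxx; ring.
have BE x y : B x y = if y == b then A x b - q * A x a else A x y.
  by rewrite mxE mulNr.
have suppB : (#|[set x | B x.1 x.2 != 0%R]| < m)%N.
  rewrite -ltnS; apply: leq_trans suppA; apply/proper_card/properP; split.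
    (* A zero of [A] stays zero: its new value is at most 0, and [B] is totally nonnegative. *)
    apply/subsetP => -[x y]; rewrite !inE /=; apply: contraNneq => Axy.
    apply/eqP/le_anti; rewrite totally_nonnegative_ge0 // andbT BE.
    case: eqP => [e|_]; last by rewrite Axy.
    by rewrite -e Axy add0r oppr_le0 mulr_ge0 ?totally_nonnegative_ge0.
  exists (i0, b); rewrite !inE //= negbK BE eqxx /q divfK ?subrr //.
have IHB (T' : {set 'I_n}) : #|S| = #|T'|.+1 -> 0 <= partial_sum B S p l T' by apply: IHm.
rewrite AB; have [aT|aT] := boolP (a \in T).
  by rewrite partial_sum_coladd_mem // IHB.
have [bT|bT] := boolP (b \in T); last first.
  by apply: le_trans (partial_sum_coladd_notin _ _ _ _ _ _ _ _) => //; apply: IHB.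
rewrite partial_sum_coladd_swap // addr_ge0 ?IHB // mulr_ge0 // IHB //.
by rewrite ST (cardsD1 b T) bT cardsU1 !inE (negbTE aT) andbF.
Qed.

Theorem theoremB (R : realType) (n : nat) (hn : (1 <= n)%N) (T : {set 'I_n})
    (p : 'I_n) (S : {set 'I_n}) (hS : S \subset [set~ p])
    (hST : #|S| = (#|T| + 1)%N)
    (l : nat) (hl : (1 <= l <= #|~: T|)%N)
    (A : 'M[R]_n) (hA : totally_nonnegative A) :
  0 <= (-1) ^+ (1 + l) *
       \sum_(k < #|~: T| | (k < l)%N)
          (-1) ^+ (1 + k.+1) * minor A S (T :|: [set enum_val k])
                             * minor A [set~ p] [set~ enum_val k].
Proof.
rewrite addn1 in hST; have := partial_sum_ge0 l hA hS hST.
rewrite /partial_sum big_mkcondr.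
rewrite (@big_enumerates _ _ _ _ (@enum_val _ (mem (~: T))) _ erefl); last first.
  by move=> k; rewrite enum_valP rank_in_enum_val.
rewrite -big_mkcond => /= pos; rewrite mulr_sumr; apply: etrans pos.
congr (0 <= _); apply: eq_big => k; rewrite rank_in_enum_val // setUC => _.
(* The ordinal [k] is zero-based: it stands for the index [k.+1] of the theorem and is the rank of
   its column. *)
have -> : (-1) ^+ (1 + k.+1) = (-1) ^+ k :> R by rewrite !exprS mulrA mulrNN !mul1r.
by rewrite (exprD _ (1 + l) k) !mulrA.
Qed.
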